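(* For every positive integer $k$, every $k$-chromatic graph $G$ that is a minimal (with respect to the minor relation) counterexample to Hadwiger's Conjecture is $\lceil k/8\rceil$-connected.
   Context: Graphs are finite and simple. A graph $H$ is a minor of a graph $G$ if $H$ can be obtained from a subgraph of $G$ by contracting edges. A graph is $k$-chromatic if its chromatic number equals $k$. Hadwiger's Conjecture states that, for every $k$, every $k$-chromatic graph contains a $K_k$-minor. A counterexample to Hadwiger's Conjecture is a graph $H$ that has no $K_{\chi(H)}$-minor, where $\chi(H)$ is the chromatic number of $H$. It is minimal with respect to the minor relation if none of its proper minors is a counterexample. A graph is $m$-connected (vertex connectivity) if it has more than $m$ vertices and remains connected after the deletion of any set of fewer than $m$ vertices. *)

(* Defs.v *)
From mathcomp Require Import all_boot.

Set Implicit Arguments.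
Unset Strict Implicit.
Unset Printing Implicit Defensive.

Record graph := Graph {
  vertex :> finType;
  edge : rel vertex;
  edge_sym : symmetric edge;
  edge_irr : irreflexive edge
}.
Arguments edge {g} x y.

Definition isomorphic (G H : graph) : Prop :=
  exists2 f : G -> H, bijective f & {mono f : x y / edge x y}.

(* [H] is, up to isomorphism, a (not necessarily induced) subgraph of [G]. *)
Definition subgraph (H G : graph) : Prop :=
  exists2 f : H -> G, injective f & {homo f : x y / edge x y}.

Section Contract.
Variables (G : graph) (u v : G).

(* The vertex [v] is merged into [u]: [v] is removed and [u] inherits its
   neighbours; the loop at [u] and parallel edges are dropped. *)
Definition contract_vertex : finType := {x : G | x != v}.

Definition contract_rel : rel contract_vertex :=
  fun x y => (x != y) && [|| edge (val x) (val y),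
                             (val x == u) && edge v (val y)
                           | (val y == u) && edge v (val x)].

Fact contract_sym : symmetric contract_rel.
Proof.
by move=> x y; rewrite /contract_rel eq_sym edge_sym; congr (_ && (_ || _));
   rewrite orbC.
Qed.

Fact contract_irr : irreflexive contract_rel.
Proof. by move=> x; rewrite /contract_rel eqxx. Qed.

Definition contract : graph := Graph contract_sym contract_irr.

End Contract.

(* [contracts_to G H]: contracting zero or more edges, one after the other,
   turns [G] into a graph isomorphic to [H]. *)
Inductive contracts_to (G H : graph) : Prop :=
| contracts_done of isomorphic G H
| contracts_step (u v : G) of edge u v & contracts_to (contract u v) H.

Definition minor (H G : graph) : Prop :=
  exists2 S : graph, subgraph S G & contracts_to S H.

Definition proper_minor (H G : graph) : Prop :=
  minor H G /\ ~ isomorphic H G.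

Section Complete.
Variable n : nat.

Definition complete_rel : rel 'I_n := fun i j => i != j.

Fact complete_sym : symmetric complete_rel.
Proof. by move=> i j; rewrite /complete_rel eq_sym. Qed.

Fact complete_irr : irreflexive complete_rel.
Proof. by move=> i; rewrite /complete_rel eqxx. Qed.

Definition complete : graph := Graph complete_sym complete_irr.

End Complete.

Definition colorable (G : graph) (n : nat) : bool :=
  [exists c : {ffun G -> 'I_n},
    [forall x : G, forall y : G, edge x y ==> (c x != c y)]].

Fact colorable_exists (G : graph) : exists n, colorable G n.
Proof.
exists #|G|; apply/existsP; exists [ffun x => enum_rank x].
apply/forallP=> x; apply/forallP=> y; apply/implyP=> exy.
rewrite !ffunE (inj_eq enum_rank_inj); apply/eqP=> xy.
by rewrite xy edge_irr in exy.
Qed.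

Definition chromatic_number (G : graph) : nat := ex_minn (colorable_exists G).

Definition hadwiger_counterexample (G : graph) : Prop :=
  ~ minor (complete (chromatic_number G)) G.

Definition minimal_counterexample (G : graph) : Prop :=
  hadwiger_counterexample G /\
  forall H : graph, proper_minor H G -> ~ hadwiger_counterexample H.

Section Delete.
Variables (G : graph) (S : {set G}).

Definition delete_vertex : finType := {x : G | x \notin S}.

Definition delete_rel : rel delete_vertex := fun x y => edge (val x) (val y).

Fact delete_sym : symmetric delete_rel.
Proof. by move=> x y; exact: edge_sym. Qed.

Fact delete_irr : irreflexive delete_rel.
Proof. by move=> x; exact: edge_irr. Qed.

Definition delete : graph := Graph delete_sym delete_irr.

End Delete.

Definition connected (G : graph) : Prop := forall x y : G, connect edge x y.

Definition m_connected (m : nat) (G : graph) : Prop :=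
  m < #|G| /\ forall S : {set G}, #|S| < m -> connected (delete S).

(* The ceiling of m / d, for d > 0. *)
Definition ceil_div (m d : nat) : nat := (m + d.-1) %/ d.

(* Main.v *)
Require Import Defs.
From mathcomp Require Import all_boot perm zify.

(* Let S be a smallest separator, l = |S|, and suppose 8 l < k; let W be one side
   of S. If G[W] were (k-1-l)-colourable, a (k-1)-colouring of G - W would extend to
   G using colours not occurring on S; so chi(G[W]) >= k - l, and since G[W] is a
   proper minor of G it has a clique minor of order k - l > 2l. No fewer than l
   vertices separate S from a bag of this minor, which yields a K_l minor of
   G[W + S] rooted at S. Contracting it inside W shows that the other side, with S
   turned into a clique, is a proper minor of G, hence (k-1)-colourable. This holds
   for both sides; the two colourings are injective on S, so they agree on S after
   permuting colours, and G is (k-1)-colourable. *)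

Set Implicit Arguments.
Unset Strict Implicit.
Unset Printing Implicit Defensive.

(** * Menger's theorem *)

(* Connectivity of [E] in the graph [e], stated as an induction principle. *)
Definition set_connected (T : finType) (e : rel T) (E : {set T}) : Prop :=
  forall (x : T) (F : {set T}), x \in E -> x \in F ->
    (forall a b, a \in F -> a \in E -> b \in E -> e a b -> b \in F) ->
  E \subset F.

(** The vertex type stays [T]: vertices outside [Y] become isolated, so the induction for Menger's
    theorem needs no subtypes. *)
Definition restrict (T : finType) (e : rel T) (Y : {set T}) : rel T :=
  fun x y => [&& x \in Y, y \in Y & e x y].

Definition nbhd (T : finType) (e : rel T) (W : {set T}) : {set T} :=
  [set y | (y \notin W) && [exists x in W, e x y]].

Definition separation (T : finType) (e : rel T) (X Y : {set T}) : bool :=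
  (X :|: Y == setT) && [forall x in X :\: Y, forall y in Y :\: X, ~~ e x y].

(** Connected sets replace the disjoint paths of Menger's theorem. They are indexed by vertices, so
    that a separator can itself serve as the index set. *)
Definition linked (T : finType) (e : rel T) (A B : {set T}) (k : nat) : Prop :=
  exists (R : {set T}) (g : T -> {set T}),
    [/\ #|R| = k,
        forall r, r \in R -> [/\ set_connected e (g r),
          exists2 a, a \in A & a \in g r & exists2 b, b \in B & b \in g r]
      & forall r r', r \in R -> r' \in R -> r != r' -> [disjoint g r & g r']].

Section FiniteGraphs.
Variable T : finType.
Implicit Types (e : rel T) (A B E F S W X Y Z : {set T}).

Lemma restrict_sym e Y : symmetric e -> symmetric (restrict e Y).
Proof. by move=> es x y; rewrite /restrict es andbCA. Qed.

Lemma set_connected1 e x : set_connected e [set x].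
Proof. by move=> y F /set1P-> xF _; rewrite sub1set. Qed.

Lemma set_connected_subrel e e' E :
  subrel e e' -> set_connected e E -> set_connected e' E.
Proof.
move=> ee' cE x F xE xF clF; apply: (cE x) => // a b aF aE bE /ee'.
exact: clF.
Qed.

(** The disjunction covers sets sharing a vertex and sets joined by an edge; both occur when
    linkages are glued. *)
Lemma set_connectedU e E F a b : symmetric e ->
  set_connected e E -> set_connected e F -> a \in E -> b \in F ->
  (a == b) || e a b -> set_connected e (E :|: F).
Proof.
move=> es cE cF aE bF ab x H xEF xH clH.
have clE : forall y, y \in E -> y \in H -> E \subset H.
  move=> y yE yH; apply: (cE y) => // c d cH cE' dE'; apply: clH => //;
    by rewrite inE ?cE' ?dE'.
have clF : forall y, y \in F -> y \in H -> F \subset H.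
  move=> y yE yH; apply: (cF y) => // c d cH cE' dE'; apply: clH => //;
    by rewrite inE ?cE' ?dE' orbT.
have aEF : a \in E :|: F by rewrite inE aE.
have bEF : b \in E :|: F by rewrite inE bF orbT.
have [aH bH] : a \in H /\ b \in H.
  case/setUP: xEF => [xE|xF].
    have aH := subsetP (clE x xE xH) a aE; split=> //.
    by case/orP: ab => [/eqP<- //|]; apply: clH.
  have bH := subsetP (clF x xF xH) b bF; split=> //.
  by case/orP: ab => [/eqP-> //|]; rewrite es; apply: clH.
by rewrite subUset (clE a) // (clF b).
Qed.

(** A starting point in [Y] is required because a singleton outside [Y] is connected too. *)
Lemma set_connected_restrict e Y E x :
  set_connected (restrict e Y) E -> x \in E -> x \in Y -> E \subset Y.
Proof. by move=> cE xE xY; apply: (cE x) => // a b _ _ _ /and3P[]. Qed.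

Lemma set_connected_edge e E x y : set_connected e E ->
  x \in E -> y \in E -> x != y -> exists2 z, z \in E & (x != z) && e x z.
Proof.
move=> cE xE yE xy; apply/exists_inP; apply: contraR xy => /exists_inPn no.
have /subsetP/(_ y yE)/set1P-> // : E \subset [set x].
apply: (cE x) => //; first exact: set11.
move=> a b /set1P-> _ bE xb; have := no b bE.
by rewrite xb andbT negbK inE eq_sym.
Qed.

Lemma set_connected_bigcup (T' : finType) (e' : rel T') (E' : {set T'}) e
    (phi : T' -> {set T}) :
  set_connected e' E' -> (forall h, set_connected e (phi h)) ->
  (forall a b, a \in E' -> b \in E' -> e' a b ->
     exists2 x, x \in phi a & exists2 y, y \in phi b & e x y) ->
  set_connected e (\bigcup_(h in E') phi h).
Proof.
move=> cE' cphi lift x F /bigcupP[h hE' xh] xF clF.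
have subP h' y : h' \in E' -> y \in phi h' -> y \in F -> phi h' \subset F.
  move=> h'E yh yF; apply: (cphi h' y) => // a b aF ah bh.
  by apply: clF => //; apply/bigcupP; exists h'.
have := cE' h [set h' | phi h' \subset F] hE'.
rewrite inE (subP h x) // => /(_ isT) sub.
apply/bigcupsP=> h' h'E; suff: h' \in [set h' | phi h' \subset F] by rewrite inE.
apply: (subsetP (sub _)) => // a b; rewrite !inE => aF aE bE /lift[] // y ya [z zb yz].
apply: (subP b z) => //; apply: clF yz; first exact: (subsetP aF).
  by apply/bigcupP; exists a.
by apply/bigcupP; exists b.
Qed.

Lemma nbhdP e W y :
  reflect (y \notin W /\ exists2 x, x \in W & e x y) (y \in nbhd e W).
Proof.
rewrite inE; apply: (iffP andP) => -[yW] => [/exists_inP|] ex; split=> //.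
exact/exists_inP.
Qed.

(** The union of the two neighbourhoods on the left lies in the union of those on the right, and
    likewise for the intersections. *)
Lemma nbhd_submodular e W1 W2 :
  #|nbhd e (W1 :&: W2)| + #|nbhd e (W1 :|: W2)| <= #|nbhd e W1| + #|nbhd e W2|.
Proof.
rewrite -cardsUI -[X in _ <= X]cardsUI leq_add //; apply: subset_leq_card;
  apply/subsetP=> y; rewrite 2!in_setU || rewrite 2!in_setI.
- case/orP=> /nbhdP[].
    rewrite inE negb_and => /orP[] yW [x /setIP[x1 x2] xy]; apply/orP.
      by left; apply/nbhdP; split=> //; exists x.
    by right; apply/nbhdP; split=> //; exists x.
  rewrite inE negb_or => /andP[y1 y2] [x /setUP[] xW xy]; apply/orP.
    by left; apply/nbhdP; split=> //; exists x.
  by right; apply/nbhdP; split=> //; exists x.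
case/andP=> /nbhdP[_ [x /setIP[x1 x2] xy]] /nbhdP[].
rewrite inE negb_or => /andP[y1 y2] _.
by apply/andP; split; apply/nbhdP; split=> //; exists x.
Qed.

Lemma separationP e X Y :
  reflect (X :|: Y = setT /\
           forall x y, x \in X -> x \notin Y -> y \in Y -> y \notin X -> ~~ e x y)
          (separation e X Y).
Proof.
apply: (iffP andP) => [[/eqP XY /forall_inP no]|[XY no]]; split=> //.
- move=> x y xX xY yY yX.
  have xD : x \in X :\: Y by rewrite inE xY.
  by have /forall_inP := no x xD; apply; rewrite inE yX.
- exact/eqP.
apply/forall_inP=> x /setDP[xX xY]; apply/forall_inP=> y /setDP[yY yX].
exact: no.
Qed.

Lemma separationC e X Y : symmetric e -> separation e X Y = separation e Y X.
Proof.
move=> es; have imp X' Y' : separation e X' Y' -> separation e Y' X'.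
  case/separationP=> XY no; apply/separationP; rewrite setUC; split=> // x y.
  by move=> xX xY yY yX; rewrite es; apply: no.
by apply/idP/idP; apply: imp.
Qed.

(** Choosing a point of [Z] in each [g r] is injective by disjointness, hence a bijection from [R]
    to [Z] by cardinality; [f] is its inverse, with value [i0] where there is none. *)
Lemma disjoint_reps (I : finType) (R : {set I}) (g : I -> {set T}) Z :
  #|R| = #|Z| -> (forall r, r \in R -> exists2 z, z \in Z & z \in g r) ->
  (forall r r', r \in R -> r' \in R -> r != r' -> [disjoint g r & g r']) ->
  forall i0 : I, exists2 f : T -> I,
    forall z, z \in Z -> f z \in R /\ z \in g (f z) & {in Z &, injective f}.
Proof.
move=> cRZ meet dis i0.
have [->|[z0 z0Z]] := set_0Vmem Z.
  by exists (fun=> i0) => z; rewrite inE.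
pose h r := odflt z0 [pick z in Z :&: g r].
have hP r : r \in R -> h r \in Z /\ h r \in g r.
  move=> rR; rewrite /h; case: pickP => [z /setIP[]//|no].
  by have [z zZ zg] := meet r rR; have := no z; rewrite inE zZ zg.
have hinj : {in R &, injective h}.
  move=> r r' rR r'R hh; apply: contraTeq isT => rr'.
  have /pred0P/(_ (h r)) := dis r r' rR r'R rr'.
  by rewrite /= {2}hh (hP r rR).2 (hP r' r'R).2.
have hR : h @: R = Z.
  apply/eqP; rewrite eqEcard card_in_imset // cRZ leqnn andbT.
  by apply/subsetP=> _ /imsetP[r rR ->]; case: (hP r rR).
pose f z := odflt i0 [pick r in R | h r == z].
have fP z : z \in Z -> f z \in R /\ h (f z) = z.
  rewrite -{1}hR /f => /imsetP[r rR ->].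
  case: pickP => [r' /andP[r'R /eqP]//|/(_ r)].
  by rewrite rR eqxx.
exists f => [z zZ|z z' zZ z'Z ff].
  by have [fR fz] := fP z zZ; split=> //; rewrite -{1}fz; case: (hP _ fR).
by rewrite -(fP z zZ).2 ff (fP z' z'Z).2.
Qed.

(* In Goering's proof of Menger's theorem, an edge [ab] is deleted; a separation
   [X, Y] of the remaining graph that is too small gives two instances of the
   theorem, of which this is the one inside [X], with target [a |: X :&: Y]. *)
Lemma menger_half e e' A B X Y a b k :
  symmetric e' ->
  (forall c d, e c d -> [\/ e' c d, c = a /\ d = b | c = b /\ d = a]) ->
  A \subset X -> B \subset Y -> separation e' X Y ->
  b \notin X ->
  (forall X' Y', A \subset X' -> B \subset Y' -> separation e X' Y' ->
     k <= #|X' :&: Y'|) ->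
  forall X1 Y1, A \subset X1 -> a |: (X :&: Y) \subset Y1 ->
    separation (restrict e' X) X1 Y1 -> k <= #|X1 :&: Y1|.
Proof.
move=> es' ee' AX BY /separationP[XY noXY] bX big X1 Y1 AX1 TY1.
case/separationP=> XY1 no1.
have aY1 : a \in Y1 by apply: (subsetP TY1); rewrite setU11.
have cov1 v : v \notin X1 -> v \in Y1.
  by move=> vX1; have := in_setT v; rewrite -XY1 inE (negPf vX1).
(* Adding [Y] to the second side gives a separation of [e]. Its order does not grow as [X :&: Y]
   lies in [Y1], and the edge [ab] does not cross it as [a] is in [Y1] and [b] is not in [X]. *)
apply: (@leq_trans #|(X1 :&: X) :&: ((Y1 :&: X) :|: Y)|); last first.
  apply: subset_leq_card; apply/subsetP=> v; rewrite !inE.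
  case/andP=> /andP[-> vX] /orP[/andP[->//]|vY].
  by rewrite (subsetP TY1) // !inE vX vY orbT.
apply: big.
- by rewrite subsetI AX1.
- exact: subset_trans BY (subsetUr _ _).
apply/separationP; split.
  apply/setP=> v; rewrite !inE.
  have := in_setT v; rewrite -XY inE; case: (v \in Y); rewrite ?orbT // orbF => ->.
  by rewrite !andbT orbF; have := in_setT v; rewrite -XY1 inE.
move=> c d; rewrite !inE => /andP[cX1 cX].
rewrite cX andbT negb_or => /andP[cY1 cY] dY; rewrite negb_and => dX.
apply/negP=> /ee'[cd|[ca _]|[cb _]].
- have dX' : d \in X.
    apply: contraT => dX'; have : d \in Y by move: dY; rewrite (negPf dX') andbF.
    by move=> dY'; have := noXY c d cX cY dY' dX'; rewrite cd.
  move: dX; rewrite dX' orbF => dX1.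
  by have := no1 c d cX1 cY1 (cov1 d dX1) dX1; rewrite /restrict cX dX' cd.
- by rewrite ca aY1 in cY1.
by rewrite -cb cX in bX.
Qed.

(** Induction on the number of edges. If deleting an edge creates a separation of order below [k],
    the linkages obtained on its two sides are glued along the separator and the deleted edge. *)
Lemma menger e A B k : symmetric e ->
  (forall X Y, A \subset X -> B \subset Y -> separation e X Y ->
     k <= #|X :&: Y|) ->
  linked e A B k.
Proof.
have [n] := ubnP #|[set p : T * T | e p.1 p.2]|.
elim: n e A B => // n IHn e A B en es big.
have [/existsP[x /existsP[y exy]]|noe] := boolP [exists x, exists y, e x y]; last first.
  (* Without edges every cover is a separation, so [A] and [~: A :|: B] give the bound and
     singletons form the linkage. *)
  have kAB : k <= #|A :&: B|.
    apply: leq_trans (big A (~: A :|: B) (subxx _) (subsetUr _ _) _) _.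
      apply/separationP; split=> [|u v _ _ _ _]; first by rewrite setUA setUCr setTU.
      by apply: contra noe => uv; apply/existsP; exists u; apply/existsP; exists v.
    by rewrite setIUr setICr set0U.
  have [R] : exists R : {set T}, (R \subset A :&: B) && (#|R| == k).
    have /set0Pn[R] : [set R : {set T} | R \subset A :&: B & #|R| == k] != set0.
      by rewrite -card_gt0 cards_draws bin_gt0.
    by rewrite inE => RP; exists R.
  case/andP=> /subsetP RAB /eqP cR; exists R, (fun r => [set r]); split=> //.
    move=> r /RAB/setIP[rA rB]; split; first exact: set_connected1.
      by exists r; rewrite ?set11.
    by exists r; rewrite ?set11.
  by move=> r r' _ _ rr'; rewrite disjoints1 inE.
pose e' : rel T := fun c d => e c d && ~~ ((c == x) && (d == y) || (c == y) && (d == x)).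
have es' : symmetric e'.
  by move=> c d; rewrite /e' es; congr (_ && ~~ _); rewrite orbC andbC (andbC (c == x)).
have se' : subrel e' e by move=> c d /andP[].
have small (e1 : rel T) : subrel e1 e' -> #|[set p : T * T | e1 p.1 p.2]| < n.
  move=> s1; rewrite -ltnS; apply: leq_trans en; rewrite ltnS; apply: proper_card.
  apply/properP; split; first by apply/subsetP=> p; rewrite !inE => /s1/se'.
  exists (x, y); rewrite inE //=; apply/negP=> /s1.
  by rewrite /e' !eqxx /= andbF.
have [/forallP allbig|] := boolP [forall X : {set T}, forall Y : {set T},
    [&& A \subset X, B \subset Y & separation e' X Y] ==> (k <= #|X :&: Y|)].
  have [||R [g [cR gP dis]]] := IHn e' A B _ es'; first exact: small.
    move=> X Y AX BY XY; have /forallP/(_ Y)/implyP := allbig X; apply.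
    by rewrite AX BY.
  exists R, g; split=> // r /gP[cg gA gB]; split=> //.
  exact: set_connected_subrel cg.
rewrite negb_forall => /existsP[X]; rewrite negb_forall => /existsP[Y].
rewrite negb_imply => /andP[/and3P[AX BY XY']]; rewrite -ltnNge => ltk.
have [XYT noXY] := separationP _ _ _ XY'.
(* Being too small, [X], [Y] is no separation of [e]; the crossing edge can only be the deleted one,
   now oriented from [X] to [Y]. *)
have [a [b [aX aY bX bY eab]]] :
    exists a b, [/\ a \in X, a \notin Y, b \notin X, b \in Y & e a b].
  have : ~~ separation e X Y.
    by apply: contraL ltk => sXY; rewrite -leqNgt; apply: big.
  rewrite /separation XYT eqxx /= negb_forall_in => /exists_inP[a /setDP[aX aY]].
  rewrite negb_forall_in => /exists_inP[b /setDP[bY bX]] /negPn eab.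
  by exists a, b.
have abxy : (a = x /\ b = y) \/ (a = y /\ b = x).
  have := noXY a b aX aY bY bX; rewrite /e' eab /= negbK.
  by case/orP=> /andP[/eqP-> /eqP->]; [left | right].
have ee' c d : e c d -> [\/ e' c d, c = a /\ d = b | c = b /\ d = a].
  move=> cd; have [|] := boolP (e' c d); first by constructor 1.
  rewrite /e' cd /= negbK => cdxy.
  case: abxy cdxy => -[-> ->] /orP[] /andP[/eqP-> /eqP->];
    by [constructor 2 | constructor 3].
have ee'C c d : e c d -> [\/ e' c d, c = b /\ d = a | c = a /\ d = b].
  by case/ee'=> ?; [constructor 1 | constructor 3 | constructor 2].
have aT : a \notin X :&: Y by rewrite inE (negPf aY) andbF.
have bT : b \notin X :&: Y by rewrite inE (negPf bX).
(* Moving [b] into [X] repairs the separation for [e] at the cost of one vertex, so the order was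
   exactly [k - 1]. *)
have cT : #|X :&: Y|.+1 = k.
  apply/eqP; rewrite eqn_leq ltk /=.
  apply: leq_trans (big (b |: X) Y _ BY _) _.
  - exact: subset_trans AX (subsetUr _ _).
  - apply/separationP; split; first by rewrite -setUA XYT setUT.
    move=> c d; rewrite !inE negb_or => /orP[/eqP->|cX]; first by rewrite bY.
    move=> cY dY /andP[db dX]; apply/negP=> /ee'[cd|[_ dE]|[_ dE]].
    + by have := noXY c d cX cY dY dX; rewrite cd.
    + by rewrite dE eqxx in db.
    by rewrite dE aX in dX.
  have -> : (b |: X) :&: Y = b |: (X :&: Y).
    by apply/setP=> v; rewrite !inE; case: eqVneq => // ->; rewrite bY.
  by rewrite cardsU1 bT.
have [||R1 [g1 [cR1 g1P dis1]]] :=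
    IHn (restrict e' X) A (a |: (X :&: Y)) _ (restrict_sym X es').
- by apply: small => c d /and3P[].
- exact: (menger_half es' ee' AX BY XY' bX big).
have [||R2 [g2 [cR2 g2P dis2]]] :=
    IHn (restrict e' Y) B (b |: (X :&: Y)) _ (restrict_sym Y es').
- by apply: small => c d /and3P[].
- rewrite setIC; apply: (menger_half es' ee'C BY AX _ aY) => //.
    by rewrite separationC.
  by move=> X' Y' BX' AY' sX'Y'; rewrite setIC; apply: big; rewrite // separationC.
have [||f1 f1P f1inj] := disjoint_reps (Z := a |: (X :&: Y)) _ _ dis1 a.
- by rewrite cR1 cardsU1 aT add1n cT.
- by move=> r /g1P[].
have [||f2 f2P f2inj] := disjoint_reps (Z := b |: (X :&: Y)) _ _ dis2 a.
- by rewrite cR2 cardsU1 bT add1n cT.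
- by move=> r /g2P[].
(* The set reaching [a] is continued by the one at [b] across the edge [ab]; every other set is
   continued at the same separator vertex. *)
pose sg t := if t == a then b else t.
have sgT t : t \in a |: (X :&: Y) -> sg t \in b |: (X :&: Y).
  rewrite /sg in_setU1; case: eqP => [_ _|_ /= tT]; first exact: setU11.
  by rewrite in_setU1 tT orbT.
have sginj : {in a |: (X :&: Y) &, injective sg}.
  move=> t t'; rewrite /sg !in_setU1.
  case: (eqVneq t a) => [->|ta]; case: (eqVneq t' a) => [->|t'a] //= tT t'T tt'.
    by rewrite -tt' (negPf bT) in t'T.
  by rewrite tt' (negPf bT) in tT.
have sub1 t : t \in a |: (X :&: Y) -> g1 (f1 t) \subset X.
  move=> tT; have [/g1P[cg _ _] tg] := f1P t tT.
  apply: set_connected_restrict cg tg _.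
  by case/setU1P: tT => [->|/setIP[]].
have sub2 t : t \in b |: (X :&: Y) -> g2 (f2 t) \subset Y.
  move=> tT; have [/g2P[cg _ _] tg] := f2P t tT.
  apply: set_connected_restrict cg tg _.
  by case/setU1P: tT => [->|/setIP[]].
have uniq1 t v : t \in a |: (X :&: Y) -> v \in X :&: Y -> v \in g1 (f1 t) -> v = t.
  move=> tT vT vg; have vT' : v \in a |: (X :&: Y) by rewrite in_setU1 vT orbT.
  apply: f1inj => //; apply: contraTeq isT => ne.
  have /pred0P/(_ v) := dis1 _ _ (f1P v vT').1 (f1P t tT).1 ne.
  by rewrite /= vg (f1P v vT').2.
have uniq2 t v : t \in b |: (X :&: Y) -> v \in X :&: Y -> v \in g2 (f2 t) -> v = t.
  move=> tT vT vg; have vT' : v \in b |: (X :&: Y) by rewrite in_setU1 vT orbT.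
  apply: f2inj => //; apply: contraTeq isT => ne.
  have /pred0P/(_ v) := dis2 _ _ (f2P v vT').1 (f2P t tT).1 ne.
  by rewrite /= vg (f2P v vT').2.
(* Sets of the two halves can meet only in [X :&: Y], where each vertex belongs to the set it
   represents and to no other of that half. *)
have cross t t' v : t \in a |: (X :&: Y) -> t' \in a |: (X :&: Y) ->
    v \in g1 (f1 t) -> v \in g2 (f2 (sg t')) -> t = t'.
  move=> tT t'T v1 v2.
  have vT : v \in X :&: Y.
    by rewrite inE (subsetP (sub1 t tT)) // (subsetP (sub2 _ (sgT t' t'T))).
  have vt := uniq1 t v tT vT v1.
  have := uniq2 _ v (sgT t' t'T) vT v2.
  rewrite -vt /sg; case: eqP => // _ vb.
  by rewrite -vb vT in bT.
exists (a |: (X :&: Y)), (fun t => g1 (f1 t) :|: g2 (f2 (sg t))); split.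
- by rewrite cardsU1 aT.
- move=> t tT; have [/g1P[c1 [u uA ug] _] t1] := f1P t tT.
  have [/g2P[c2 [w wB wg] _] t2] := f2P _ (sgT t tT).
  split; last 2 first.
  + by exists u; rewrite // inE ug.
  + by exists w; rewrite // inE wg orbT.
  have sub Y' : subrel (restrict e' Y') e by move=> c d /and3P[_ _ /se'].
  apply: (set_connectedU es (set_connected_subrel (@sub _) c1)
           (set_connected_subrel (@sub _) c2) t1 t2).
  by rewrite /sg; case: (eqVneq t a) => [->|_]; rewrite ?eqxx ?eab ?orbT.
move=> t t' tT t'T tt'; apply/pred0P=> v /=; apply/negP=> /andP[].
case/setUP=> v1 /setUP[] v2.
- have ne : f1 t != f1 t' by apply: contraNneq tt' => ff; apply/eqP/f1inj.
  have /pred0P/(_ v) := dis1 _ _ (f1P t tT).1 (f1P t' t'T).1 ne.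
  by rewrite /= v1 v2.
- by rewrite (cross t t' v) ?eqxx in tt'.
- by rewrite (cross t' t v) ?eqxx in tt'.
have ne : f2 (sg t) != f2 (sg t').
  apply: contraNneq tt' => ff; apply/eqP/sginj => //.
  by apply: f2inj ff; apply: sgT.
have /pred0P/(_ v) := dis2 _ _ (f2P _ (sgT t tT)).1 (f2P _ (sgT t' t'T)).1 ne.
by rewrite /= v1 v2.
Qed.

End FiniteGraphs.

(** * Rooted clique minors *)

Lemma set_connected_imset (T T' : finType) (e : rel T) (e' : rel T') (c : T -> T')
    (E : {set T}) :
  (forall a b, a \in E -> b \in E -> e a b -> c a != c b -> e' (c a) (c b)) ->
  set_connected e E -> set_connected e' (c @: E).
Proof.
move=> hom cE x F /imsetP[x' xE ->] xF clF.
have /subsetP sub : E \subset c @^-1: F.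
  apply: (cE x') => //; first by rewrite inE.
  move=> a b; rewrite !inE => aF aE bE ab.
  have [<- //|ne] := eqVneq (c a) (c b).
  by apply: clF (hom a b aE bE ab ne) => //; apply: imset_f.
by apply/subsetP=> _ /imsetP[y /sub yF ->]; rewrite inE in yF.
Qed.

Definition rooted_clique (T : finType) (e : rel T) (S : {set T})
    (E : T -> {set T}) : Prop :=
  (forall s, s \in S -> s \in E s /\ set_connected e (E s)) /\
  (forall s s', s \in S -> s' \in S -> s != s' -> [disjoint E s & E s'] /\
     exists2 x, x \in E s & exists2 y, y \in E s' & e x y).

(* No fewer than [#|S|] vertices separate [S] from a bag [D i]. *)
Definition well_linked (T I : finType) (e : rel T) (S : {set T})
    (D : I -> {set T}) : bool :=
  [forall W : {set T}, [disjoint W & S] && [exists i, D i \subset W] ==>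
     (#|S| <= #|nbhd e W|)].

(** * Contracting an edge on a fixed vertex type *)

Section Contraction.
Variables (T : finType) (e : rel T) (u v : T).

(** Unlike in [contract], the vertex [v] is kept; for [u != v] it becomes isolated in
    [collapse_rel]. Repeated contractions thus stay on one type and leave [S] unchanged. *)
Definition collapse (x : T) : T := if x == v then u else x.

Definition collapse_rel : rel T := fun a b =>
  (a != b) && [exists x, exists y, [&& collapse x == a, collapse y == b & e x y]].

Lemma collapse_relP a b : reflect (a != b /\ exists x y,
    [/\ collapse x = a, collapse y = b & e x y]) (collapse_rel a b).
Proof.
apply: (iffP andP) => -[ab].
  by case/existsP=> x /existsP[y /and3P[/eqP xa /eqP yb xy]]; split=> //; exists x, y.
case=> x [y [xa yb xy]]; split=> //.
by apply/existsP; exists x; apply/existsP; exists y; rewrite xa yb xy !eqxx.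
Qed.

Lemma collapse_rel_sym : symmetric e -> symmetric collapse_rel.
Proof.
move=> es; have imp a b : collapse_rel a b -> collapse_rel b a.
  case/collapse_relP=> ab [x [y [xa yb xy]]]; apply/collapse_relP.
  by rewrite eq_sym; split=> //; exists y, x; rewrite es.
by move=> a b; apply/idP/idP; apply: imp.
Qed.

Lemma collapse_edge x y : collapse x != collapse y -> e x y ->
  collapse_rel (collapse x) (collapse y).
Proof. by move=> ne xy; apply/collapse_relP; split=> //; exists x, y. Qed.

Lemma nbhd_preim_collapse (W : {set T}) :
  nbhd e (collapse @^-1: W) \subset collapse @^-1: nbhd collapse_rel W.
Proof.
apply/subsetP=> y /nbhdP[]; rewrite !inE => yW [x]; rewrite inE => xW xy.
rewrite yW; apply/exists_inP; exists (collapse x) => //.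
by apply: collapse_edge => //; apply: contraNneq yW => <-.
Qed.

Lemma set_connected_preim_collapse (E : {set T}) : symmetric e -> e u v ->
  set_connected collapse_rel E -> set_connected e (collapse @^-1: E).
Proof.
move=> es uv cE.
have -> : collapse @^-1: E = \bigcup_(a in E) (collapse @^-1: [set a]).
  apply/setP=> x; rewrite inE; apply/idP/bigcupP => [xE|[a aE]].
    by exists (collapse x); rewrite // !inE.
  by rewrite !inE => /eqP->.
apply: (set_connected_bigcup cE) => [a x F|a b _ _ /collapse_relP[_ [x [y [xa yb xy]]]]].
  rewrite !inE => /eqP xa xF clF; apply/subsetP=> y; rewrite !inE => /eqP ya.
  have [<- //|ne] := eqVneq x y.
  have ev : e v u by rewrite es.
  apply: clF xF _ _ _; rewrite ?inE ?xa ?ya ?eqxx //.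
  move: ne xa ya; rewrite /collapse.
  case: (eqVneq x v) => [->|xv]; case: (eqVneq y v) => [->|yv] //.
  - by move=> _ <- ->.
  - by move=> _ -> <-.
  by move=> ne xa ya; rewrite xa ya eqxx in ne.
by exists x; rewrite ?inE ?xa //; exists y; rewrite ?inE ?yb.
Qed.

Lemma card_preim_collapse (Z : {set T}) : #|collapse @^-1: Z| <= #|Z|.+1.
Proof.
apply: leq_trans (_ : #|v |: Z| <= _); last by rewrite cardsU1; case: (v \in Z).
apply: subset_leq_card; apply/subsetP=> x; rewrite !inE /collapse.
by case: (eqVneq x v).
Qed.

(** Only [u] and [v] are identified, so [collapse] is injective on a set avoiding [u]; this saves
    the extra vertex of [card_preim_collapse]. *)
Lemma card_preim_collapse_notin (A Z : {set T}) :
  u \notin A -> A \subset collapse @^-1: Z -> #|A| <= #|Z|.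
Proof.
move=> uA AZ; have inj : {in A &, injective collapse}.
  move=> x y; rewrite /collapse.
  case: (eqVneq x v) => [->|xv]; case: (eqVneq y v) => [->|yv] // xA yA E.
    by rewrite E yA in uA.
  by rewrite -E xA in uA.
rewrite -(card_in_imset inj); apply: subset_leq_card.
by apply/subsetP=> _ /imsetP[x /(subsetP AZ) xZ ->]; rewrite inE in xZ.
Qed.

End Contraction.

Section RootedClique.
Variable T : finType.
Implicit Types (e : rel T) (S W Z : {set T}).

Lemma disjoint_family_avoid n (D : 'I_n -> {set T}) Z :
  (forall i j, i != j -> [disjoint D i & D j]) -> #|Z| < n ->
  exists j, [disjoint D j & Z].
Proof.
move=> dis Zn; apply/existsP; apply: contraLR Zn => /existsPn hit.
rewrite -leqNgt.
have hit' j : exists z, z \in D j :&: Z.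
  by apply/set0Pn; rewrite setI_eq0.
pose h j := xchoose (hit' j).
have hP j : h j \in D j /\ h j \in Z by apply/setIP; apply: (xchooseP (hit' j)).
have hinj : injective h.
  move=> i j hh; apply: contraTeq isT => /dis/pred0P/(_ (h i)).
  by rewrite /= {2}hh (hP i).1 (hP j).1.
rewrite -[n]card_ord -(card_imset _ hinj); apply: subset_leq_card.
by apply/subsetP=> _ /imsetP[j _ ->]; case: (hP j).
Qed.

Lemma well_linkedP (I : finType) e S (D : I -> {set T}) :
  reflect (forall W i, [disjoint W & S] -> D i \subset W -> #|S| <= #|nbhd e W|)
          (well_linked e S D).
Proof.
apply: (iffP forallP) => [wl W i WS DW|wl W].
  have /implyP := wl W; apply; rewrite WS; apply/existsP; by exists i.
by apply/implyP=> /andP[WS /existsP[i DW]]; apply: wl DW.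
Qed.

(* Contract edges inside the bags as long as [S] stays well linked to them. Then let
   [W] be a smallest set containing a bag with at most [#|S|] neighbours. If an edge
   of a bag inside [W] cannot be contracted, there is such a set [W2] with an end of
   the edge outside, and submodularity applied to [W] and [W2] contradicts the choice
   of [W]. So the bags inside [W] are singletons, and any linkage from [S] to them
   is a rooted clique. *)
Lemma rooted_clique_exists n e S (D : 'I_n -> {set T}) :
  symmetric e -> #|S|.*2 < n ->
  (forall i, set_connected e (D i)) -> (forall i, [disjoint D i & S]) ->
  (forall i j, i != j -> [disjoint D i & D j]) ->
  (forall i j, i != j -> exists2 x, x \in D i & exists2 y, y \in D j & e x y) ->
  well_linked e S D ->
  exists E, rooted_clique e S E.
Proof.
have [N] := ubnP #|\bigcup_i D i|.
elim: N e D => // N IHN e D DN es nS cD DS dis adj wl.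
have [|stuck] := boolP [exists i, exists u in D i, exists v in D i,
    [&& u != v, e u v &
        well_linked (collapse_rel e u v) S (fun j => collapse u v @: D j)]].
  case/existsP=> i /exists_inP[u ui] /exists_inP[v vi] /and3P[uv euv wl'].
  have fS s : s \in S -> collapse u v s = s.
    rewrite /collapse; case: eqP => // -> vS.
    by have /pred0P/(_ v) := DS i; rewrite /= vi vS.
  have fD j : collapse u v @: D j \subset D j :\ v.
    apply/subsetP=> _ /imsetP[x xj ->]; rewrite !inE /collapse.
    case: (eqVneq x v) xj => [-> vj|-> //]; rewrite uv /=.
    have [->//|ne] := eqVneq j i.
    by have /pred0P/(_ v) := dis j i ne; rewrite /= vi vj.
  have fD' j : collapse u v @: D j \subset D j.
    exact: subset_trans (fD j) (subsetDl _ _).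
  have [||||||E [E1 E2]] := IHN _ (fun j => collapse u v @: D j) _
     (collapse_rel_sym u v es) nS.
  - rewrite -ltnS; apply: leq_trans DN; rewrite ltnS; apply: proper_card.
    apply/properP; split.
      by apply/bigcupsP=> j _; apply: subset_trans (fD' j) (bigcup_sup j _).
    exists v; first by apply/bigcupP; exists i.
    by apply/negP=> /bigcupP[j _ /(subsetP (fD j))]; rewrite !inE eqxx.
  - move=> j; apply: set_connected_imset (cD j) => a b _ _ /[swap].
    exact: collapse_edge.
  - by move=> j; apply: disjointWl (fD' j) (DS j).
  - by move=> j j' ne; apply: disjointW (fD' j) (fD' j') (dis _ _ ne).
  - move=> j j' ne; have [x xj [y yj' xy]] := adj j j' ne.
    exists (collapse u v x); first exact: imset_f.
    exists (collapse u v y); first exact: imset_f.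
    apply: collapse_edge => //; apply/eqP=> E.
    have /pred0P/(_ (collapse u v x)) := dis j j' ne.
    by rewrite /= (subsetP (fD' j)) ?imset_f // E (subsetP (fD' j')) ?imset_f.
  - exact: wl'.
  exists (fun s => collapse u v @^-1: E s); split=> [s sS|s s' sS s'S ne].
    have [sE cE] := E1 s sS; rewrite inE fS //; split=> //.
    exact: set_connected_preim_collapse.
  have [dE [x' xE [y' yE /collapse_relP[_ [x [y [xx' yy' xy]]]]]]] :=
    E2 s s' sS s'S ne.
  split.
    by apply/pred0P=> z; rewrite /= !inE; have /pred0P/(_ (collapse u v z)) := dE.
  by exists x; rewrite ?inE ?xx' //; exists y; rewrite ?inE ?yy'.
have n0 : 0 < n by apply: leq_trans nS.
pose P W := [&& [disjoint W & S], [exists i, D i \subset W] & #|nbhd e W| <= #|S|].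
(* The complement of [S] makes the minimisation possible: all its neighbours are in [S]. *)
have P0 : P (~: S).
  apply/and3P; split.
  - by rewrite disjoints_subset.
  - by apply/existsP; exists (Ordinal n0); rewrite -disjoints_subset.
  apply: subset_leq_card; apply/subsetP=> y /nbhdP[].
  by rewrite inE negbK.
case: (arg_minnP (fun W : {set T} => #|W|) P0) => W /and3P[WS /existsP[i0 DW] NW] minW.
(* A bag that avoids the boundary of [W'] cannot leave [W'], and its adjacency to a bag inside
   forces it to enter. *)
have inW W' i j : D i \subset W' -> [disjoint D j & nbhd e W'] -> D j \subset W'.
  move=> iW jN; have [<- //|ne] := eqVneq i j.
  have step a b : a \in W' -> b \in D j -> e a b -> b \in W'.
    move=> aW bj ab; apply: contraT => bW.
    have /pred0P/(_ b) /= := jN; rewrite bj /= => /negbT/negP; case.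
    by apply/nbhdP; split=> //; exists a.
  have [x xi [y yj xy]] := adj i j ne.
  have yW : y \in W' by apply: step xy => //; apply: (subsetP iW).
  by apply: (cD j y) => // a b aW _; apply: step.
have single i x y : D i \subset W -> x \in D i -> y \in D i -> x = y.
  move=> iW xi yi; apply: contraTeq isT => xy.
  have [b bi /andP[xb exb]] := set_connected_edge (cD i) xi yi xy.
  move/existsPn/(_ i): stuck => /exists_inPn/(_ x xi) /exists_inPn/(_ b bi).
  rewrite xb exb /= negb_forall => /existsP[W1].
  rewrite negb_imply -ltnNge => /andP[/andP[W1S /existsP[j jW1]] NW1].
  set W2 := collapse x b @^-1: W1.
  have W2S : [disjoint W2 & S].
    apply/pred0P=> s /=; apply/negP=> /andP[]; rewrite inE /collapse.
    case: eqP => [->|_] sW sS; first by have /pred0P/(_ b) := DS i; rewrite /= bi sS.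
    by have /pred0P/(_ s) := W1S; rewrite /= sW sS.
  have jW2 : D j \subset W2.
    by apply/subsetP=> z zj; rewrite inE (subsetP jW1) ?imset_f.
  (* Undoing the contraction adds at most one vertex to the boundary of [W1], which had fewer than
     [#|S|]. If [x] were not on the boundary of [W2], none would be added, against [wl]. *)
  have NW2 : #|nbhd e W2| <= #|S|.
    apply: leq_trans (subset_leq_card (nbhd_preim_collapse _ _ _ _)) _.
    exact: leq_trans (card_preim_collapse _ _ _) NW1.
  have xW2 : x \notin W2.
    have [/nbhdP[]//|xN] := boolP (x \in nbhd e W2).
    have := card_preim_collapse_notin xN (nbhd_preim_collapse _ _ _ _).
    by move/leq_ltn_trans=> /(_ _ NW1); rewrite ltnNge (well_linkedP _ _ _ wl W2 j).
  (* The two boundaries have at most [2 * #|S| < n] vertices together, so some bag avoids both and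
     lies in [W :&: W2]. *)
  have [j' j'N] : exists j', [disjoint D j' & nbhd e W :|: nbhd e W2].
    apply: disjoint_family_avoid => //; apply: leq_ltn_trans nS.
    by rewrite -addnn (leq_trans (leq_card_setU _ _)) // leq_add.
  have j'W : D j' \subset W.
    by apply: inW iW _; apply: disjointWr j'N; apply: subsetUl.
  have j'W2 : D j' \subset W2.
    by apply: inW jW2 _; apply: disjointWr j'N; apply: subsetUr.
  have : #|W| <= #|W :&: W2|.
    apply: minW; apply/and3P; split.
    - exact: disjointWl (subsetIl _ _) WS.
    - by apply/existsP; exists j'; rewrite subsetI j'W.
    have US : #|S| <= #|nbhd e (W :|: W2)|.
      apply: (well_linkedP _ _ _ wl _ j'); last exact: subset_trans j'W (subsetUl _ _).
      by rewrite -setI_eq0 setIUl setU_eq0 !setI_eq0 WS.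
    rewrite -(leq_add2r #|nbhd e (W :|: W2)|).
    apply: leq_trans (nbhd_submodular _ _ _) _.
    exact: leq_add NW (leq_trans NW2 US).
  move=> le; have /setIidPl/subsetP WW2 : W :&: W2 = W.
    by apply/eqP; rewrite eqEcard subsetIl.
  by rewrite (WW2 x) // in xW2; apply: (subsetP iW).
pose K := \bigcup_(j | D j \subset W) D j.
have [X Y SX KY XY|R [g [cR gP gdis]]] := menger (A := S) (B := K) (k := #|S|) es.
  (* Given a separation of order below [#|S|], some bag avoids it and the boundary of [W]. That bag
     lies in [K], hence in [Y :\: X], whose neighbours are all in [X :&: Y]; this contradicts
     [wl]. *)
  rewrite leqNgt; apply/negP=> small.
  have [j jN] : exists j, [disjoint D j & nbhd e W :|: (X :&: Y)].
    apply: disjoint_family_avoid => //; apply: leq_ltn_trans nS.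
    by rewrite -addnn (leq_trans (leq_card_setU _ _)) // leq_add // ltnW.
  have jW : D j \subset W.
    by apply: inW DW _; apply: disjointWr jN; apply: subsetUl.
  have jXY : [disjoint D j & X :&: Y] by apply: disjointWr jN; apply: subsetUr.
  have jYX : D j \subset Y :\: X.
    apply/subsetP=> x xj; have xY : x \in Y.
      by apply: (subsetP KY); apply/bigcupP; exists j.
    rewrite inE xY andbT; have /pred0P/(_ x) := jXY.
    by rewrite /= xj inE xY andbT /= => ->.
  have := well_linkedP _ _ _ wl (Y :\: X) j _ jYX.
  rewrite leqNgt => /(_ _)/negP; apply.
    apply/pred0P=> s /=; apply/negP=> /andP[]; rewrite inE => /andP[sX _] sS.
    by rewrite (subsetP SX) in sX.
  apply: leq_ltn_trans small; apply: subset_leq_card; apply/subsetP=> y /nbhdP[yD].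
  have [XYT noXY] := separationP _ _ _ XY.
  case=> x /setDP[xY xX] xy.
  have yX : y \in X.
    apply: contraNT yD => yX; rewrite inE yX.
    by have := in_setT y; rewrite -XYT inE (negPf yX).
  rewrite inE yX; apply: contraT => yY.
  by have := noXY y x yX yY xY xX; rewrite es xy.
have gS r : r \in R -> exists2 z, z \in S & z \in g r by case/gP.
(* [disjoint_reps] asks for a default index, available unless [R], and with it [S], is empty. *)
case: (set_0Vmem R) => [R0|[r0 _]].
  have S0 : S = set0 by apply/eqP; rewrite -cards_eq0 -cR R0 cards0.
  by exists (fun=> set0); rewrite S0; split=> s; rewrite inE.
have [f fP finj] := disjoint_reps cR gS gdis r0.
exists (fun s => g (f s)); split=> [s /fP[/gP[cg _ _] sg] //|s s' sS s'S ne].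
have [fR _] := fP s sS; have [fR' _] := fP s' s'S.
have ffne : f s != f s' by apply: contraNneq ne => /finj->.
have gd := gdis _ _ fR fR' ffne; split=> //.
(* Disjoint linkage sets end in different bags, since bags inside [W] are singletons; the adjacency
   of the bags supplies the edge. *)
have [_ _ [b /bigcupP[j jW bj] bg]] := gP _ fR.
have [_ _ [b' /bigcupP[j' j'W bj'] bg']] := gP _ fR'.
have [jj|jj] := eqVneq j j'.
  rewrite -jj in bj'; have bb := single j b b' jW bj bj'.
  by have /pred0P/(_ b) := gd; rewrite /= bg bb bg'.
have [x xj [y yj' xy]] := adj j j' jj.
exists b => //; exists b' => //.
by rewrite (single j b x) // (single j' b' y).
Qed.

End RootedClique.

(** * Minors and their models *)

(** The branch sets of a minor; [minorP] identifies this with the definition by subgraphs and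
    contractions. *)
Definition is_model (H G : graph) (phi : H -> {set G}) : Prop :=
  [/\ forall h, phi h != set0,
      forall h, set_connected edge (phi h),
      forall h h', h != h' -> [disjoint phi h & phi h']
    & forall h h', edge h h' ->
        exists2 x, x \in phi h & exists2 y, y \in phi h' & edge x y].

Lemma is_model_trans (K H G : graph) (phi : K -> {set H}) (psi : H -> {set G}) :
  is_model phi -> is_model psi ->
  is_model (fun k => \bigcup_(h in phi k) psi h).
Proof.
move=> [n1 c1 d1 e1] [n2 c2 d2 e2]; split.
- move=> k; have /set0Pn[h hk] := n1 k; have /set0Pn[x xh] := n2 h.
  by apply/set0Pn; exists x; apply/bigcupP; exists h.
- by move=> k; apply: set_connected_bigcup (c1 k) _ _ => // a b _ _; apply: e2.
- move=> k k' kk'; apply/pred0P=> x /=; apply/negP=> /andP[].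
  case/bigcupP=> h hk xh /bigcupP[h' hk' xh'].
  have [hh|/d2/pred0P/(_ x)] := eqVneq h h'; last by rewrite /= xh xh'.
  by have /pred0P/(_ h) := d1 k k' kk'; rewrite /= hk hh hk'.
move=> k k' /e1[h hk [h' hk' /e2[x xh [y yh' xy]]]].
exists x; first by apply/bigcupP; exists h.
by exists y => //; apply/bigcupP; exists h'.
Qed.

Lemma is_model_inj (H G : graph) (f : H -> G) : injective f ->
  {homo f : x y / edge x y} -> is_model (fun h => [set f h]).
Proof.
move=> fI fe; split=> [h|h|h h' hh|h h' /fe fhh].
- by apply/set0Pn; exists (f h); rewrite set11.
- exact: set_connected1.
- by rewrite disjoints1 inE (inj_eq fI).
by exists (f h); rewrite ?set11 //; exists (f h'); rewrite ?set11.
Qed.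

Section ContractEdge.
Variables (G : graph) (u v : G).
Hypothesis uv : edge u v.

Let u_neq_v : u != v.
Proof. by apply: contraTneq uv => ->; rewrite edge_irr. Qed.

(** The default value of [insubd] is [u], so the removed vertex [v] is sent to [u]. *)
Definition contract_proj (x : G) : contract u v :=
  insubd (Sub u u_neq_v : contract_vertex v) x.

Lemma val_contract_proj x : val (contract_proj x) = collapse u v x.
Proof. by rewrite val_insubd /collapse; case: eqP. Qed.

Lemma contract_projK x : contract_proj (val x) = x.
Proof. by apply: val_inj; rewrite val_contract_proj /collapse (negPf (valP x)). Qed.

Lemma contract_proj_edge x y : edge x y ->
  contract_proj x != contract_proj y -> edge (contract_proj x) (contract_proj y).
Proof.
move=> xy ne; rewrite /edge /= /contract_rel ne /= !val_contract_proj /collapse.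
case: (eqVneq x v) xy => [-> vy|_ xy]; case: (eqVneq y v) => [yv|yv].
- by rewrite yv edge_irr in vy.
- by rewrite eqxx vy orbT.
- by rewrite yv edge_sym in xy; rewrite eqxx xy !orbT.
by rewrite xy.
Qed.

Lemma contract_edge_lift (a b : contract u v) : edge a b ->
  exists x y, [/\ contract_proj x = a, contract_proj y = b & edge x y].
Proof.
have uP : contract_proj v = contract_proj u.
  by apply: val_inj; rewrite !val_contract_proj /collapse eqxx (negPf u_neq_v).
case/andP=> _ /or3P[ab|/andP[/eqP au vb]|/andP[/eqP bu va]].
- by exists (val a), (val b); rewrite !contract_projK.
- by exists v, (val b); rewrite uP -au !contract_projK.
by exists (val a), v; rewrite uP -bu !contract_projK edge_sym.
Qed.

Lemma is_model_contract :
  is_model (fun x : contract u v => [set y | contract_proj y == x]).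
Proof.
split=> [x|x|x x' xx|x x' /contract_edge_lift[y [y' [yx yx' yy]]]].
- by apply/set0Pn; exists (val x); rewrite inE contract_projK.
- have -> : [set y | contract_proj y == x] = collapse u v @^-1: [set val x].
    by apply/setP=> y; rewrite !inE -val_contract_proj (inj_eq val_inj).
  apply: set_connected_preim_collapse uv _; first exact: edge_sym.
  exact: set_connected1.
- apply/pred0P=> y /=; rewrite !inE; apply: contraNF xx.
  by case/andP=> /eqP-> /eqP->.
by exists y; rewrite ?inE ?yx //; exists y'; rewrite ?inE ?yx'.
Qed.

End ContractEdge.

Lemma contracts_to_model (G H : graph) :
  contracts_to G H -> exists phi : H -> {set G}, is_model phi.
Proof.
elim=> {G H} [G H [f [g fK gK] fe]|G H u v uv _ [phi mphi]].
  exists (fun h => [set g h]); apply: is_model_inj; first exact: can_inj gK.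
  by move=> x y; rewrite -fe !gK.
by eexists; apply: is_model_trans mphi (is_model_contract uv).
Qed.

(** Induction on [#|G|]: a fibre with two vertices contains an edge, since it is connected, and [f]
    factors through its contraction; an injective [f] is an isomorphism. *)
Lemma contracts_to_map (G H : graph) (f : G -> H) :
  (forall h, exists x, f x = h) ->
  (forall h, set_connected edge [set x | f x == h]) ->
  (forall x y, edge x y -> f x != f y -> edge (f x) (f y)) ->
  (forall h h', edge h h' -> exists x y, [/\ f x = h, f y = h' & edge x y]) ->
  contracts_to G H.
Proof.
have [n] := ubnP #|G|; elim: n G f => // n IHn G f Gn surj conn hom lift.
have [/injectiveP fI|] := boolP (injectiveb f).
  apply: contracts_done.
  have sI h : exists x, f x == h by have [x <-] := surj h; exists x.
  exists f.
    exists (fun h => xchoose (sI h)) => x; last exact/eqP/(xchooseP (sI x)).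
    exact/fI/eqP/(xchooseP (sI (f x))).
  move=> x y; apply/idP/idP => [/lift[x' [y' [/fI-> /fI->]]]//|xy].
  by apply: hom => //; apply: contraTneq xy => /fI->; rewrite edge_irr.
case/injectivePn=> x [y xy fxy].
have [z] : exists2 z, z \in [set z | f z == f x] & (x != z) && edge x z.
  by apply: set_connected_edge (conn (f x)) _ _ xy; rewrite inE ?fxy.
rewrite inE => /eqP fz /andP[xz exz].
apply: (contracts_step exz).
have fproj a : f (val (contract_proj exz a)) = f a.
  by rewrite val_contract_proj /collapse; case: eqP => // ->.
apply: (IHn _ (fun a : contract x z => f (val a))).
- rewrite -ltnS; apply: leq_trans Gn; rewrite ltnS card_sig.
  apply: proper_card; apply/properP; split; first exact/subsetP.
  by exists z; rewrite ?inE ?eqxx.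
- by move=> h; have [a <-] := surj h; exists (contract_proj exz a).
- move=> h; have -> : [set a : contract x z | f (val a) == h] =
      contract_proj exz @: [set a | f a == h].
    apply/setP=> a; rewrite inE; apply/idP/imsetP => [ah|[b bh ->]].
      by exists (val a); rewrite ?inE // contract_projK.
    by rewrite fproj; rewrite inE in bh.
  by apply: set_connected_imset (conn h) => a b _ _; apply: contract_proj_edge.
- move=> a b /(contract_edge_lift exz)[a' [b' [<- <- ab]]].
  by rewrite !fproj; apply: hom.
move=> h h' hh'; have [a [b [ah bh ab]]] := lift h h' hh'.
exists (contract_proj exz a), (contract_proj exz b); rewrite !fproj; split=> //.
apply: contract_proj_edge => //; apply: contraTneq hh' => ab'.
by rewrite -ah -bh -(fproj a) ab' fproj edge_irr.
Qed.

Section ModelSubgraph.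
Variables (H G : graph) (phi : H -> {set G}).

Definition model_vertex : finType := {x : G | [exists h, x \in phi h]}.

(** Edges of [G] between bags of non-adjacent vertices are dropped, so that contracting the bags
    yields [H] itself and not a graph with more edges. *)
Definition model_rel : rel model_vertex := fun x y => edge (val x) (val y) &&
  [exists h, exists h', [&& val x \in phi h, val y \in phi h' & (h == h') || edge h h']].

Fact model_sym : symmetric model_rel.
Proof.
have imp x y : model_rel x y -> model_rel y x.
  case/andP=> xy /existsP[h /existsP[h' /and3P[xh yh hh]]].
  rewrite /model_rel edge_sym xy; apply/existsP; exists h'; apply/existsP; exists h.
  by rewrite xh yh eq_sym edge_sym.
by move=> x y; apply/idP/idP; apply: imp.
Qed.

Fact model_irr : irreflexive model_rel.
Proof. by move=> x; rewrite /model_rel edge_irr. Qed.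

Definition model_graph : graph := Graph model_sym model_irr.

End ModelSubgraph.

(** For the converse, mapping each vertex of [model_graph] to the index of its bag has connected
    fibres, and [contracts_to_map] applies. *)
Lemma minorP (H G : graph) : minor H G <-> exists phi : H -> {set G}, is_model phi.
Proof.
split=> [[S [f fI fe] /contracts_to_model[phi mphi]]|[phi [ne cphi dphi ephi]]].
  by eexists; apply: is_model_trans mphi (is_model_inj fI fe).
exists (model_graph phi).
  by exists val => [|x y /andP[]]; first exact: val_inj.
pose f (x : model_graph phi) : H := xchoose (existsP (valP x)).
have fP x : val x \in phi (f x) by apply: (xchooseP (existsP (valP x))).
have fE x h : val x \in phi h -> f x = h.
  move=> xh; apply: contraTeq isT => /dphi/pred0P/(_ (val x)).
  by rewrite /= fP xh.
have lift x h : x \in phi h -> exists2 a : model_graph phi, val a = x & f a = h.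
  move=> xh; have xP : [exists h, x \in phi h] by apply/existsP; exists h.
  by exists (Sub x xP) => //; apply: fE.
apply: (@contracts_to_map _ _ f).
- move=> h; have /set0Pn[x /lift[a _ ah]] := ne h.
  by exists a.
- move=> h; have /set0Pn[x0 /lift[a0 _ _]] := ne h.
  have -> : [set a | f a == h] = insubd a0 @: phi h.
    apply/setP=> a; rewrite inE; apply/eqP/imsetP => [<-|[x xh ->]].
      by exists (val a) => //; rewrite valKd.
    by have [b <- bh] := lift x h xh; rewrite valKd.
  apply: set_connected_imset (cphi h) => x y xh yh xy _.
  have [a ax _] := lift x h xh; have [b bY _] := lift y h yh.
  rewrite -ax -bY !valKd /edge /= /model_rel ax bY xy.
  by apply/existsP; exists h; apply/existsP; exists h; rewrite xh yh eqxx.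
- move=> a b /andP[_ /existsP[h /existsP[h' /and3P[/fE-> /fE->]]]].
  by case/orP=> [->|].
move=> h h' hh; have [x xh [y yh xy]] := ephi h h' hh.
have [a ax ah] := lift x h xh; have [b bY bh] := lift y h' yh.
exists a, b; split=> //; rewrite /edge /= /model_rel ax bY xy.
by apply/existsP; exists h; apply/existsP; exists h'; rewrite xh yh hh orbT.
Qed.

(** * Colourings *)

Lemma colorableP (G : graph) n :
  reflect (exists c : G -> 'I_n, forall x y, edge x y -> c x != c y) (colorable G n).
Proof.
apply: (iffP existsP) => [[c /forallP cP]|[c cP]].
  by exists c => x y xy; have /forallP/(_ y)/implyP := cP x; apply.
exists (finfun c); apply/forallP=> x; apply/forallP=> y; apply/implyP=> xy.
by rewrite !ffunE cP.
Qed.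

Lemma chromatic_number_leq (G : graph) n : (chromatic_number G <= n) = colorable G n.
Proof.
rewrite /chromatic_number; case: ex_minnP => m /colorableP[c cP] minm.
apply/idP/idP => [mn|/minm//].
by apply/colorableP; exists (fun x => widen_ord mn (c x)) => x y /cP.
Qed.

Lemma is_model_complete (G : graph) m n (phi : complete n -> {set G}) (mn : m <= n) :
  is_model phi -> is_model (fun i : complete m => phi (widen_ord mn i)).
Proof.
move=> [ne c d e]; split=> [h|h|h h' hh|h h' hh] //; first exact: d.
exact: e.
Qed.

(** Having fewer vertices, [H] is a proper minor and no counterexample. With more than [p] colours
    needed it would have a clique minor of order [p.+1], and so would [G]. *)
Lemma small_minor_colorable (G H : graph) p :
  minimal_counterexample G -> chromatic_number G = p.+1 ->
  minor H G -> #|H| < #|G| -> colorable H p.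
Proof.
move=> [cexG minG] chiG HG HltG; rewrite -chromatic_number_leq leqNgt.
apply/negP=> chiH; apply: (minG H).
  split=> // -[f fb _].
  by rewrite (bij_eq_card fb) ltnn in HltG.
move=> /minorP[phi mphi]; apply: cexG; rewrite chiG.
have [psi mpsi] := (minorP _ _).1 HG.
by apply/minorP; eexists; apply: is_model_trans (is_model_complete chiH mphi) mpsi.
Qed.

(** * Sides of a separation with the separator completed *)

Section Torso.
Variables (G : graph) (Y S : {set G}).

Definition torso_vertex : finType := {x : G | x \in Y}.

(** For [S = set0] this is the induced subgraph on [Y], so one construction serves for both
    purposes. *)
Definition torso_rel : rel torso_vertex := fun x y =>
  edge (val x) (val y) || [&& val x \in S, val y \in S & val x != val y].

Fact torso_sym : symmetric torso_rel.
Proof. by move=> x y; rewrite /torso_rel edge_sym andbCA (eq_sym (val x)). Qed.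

Fact torso_irr : irreflexive torso_rel.
Proof. by move=> x; rewrite /torso_rel edge_irr eqxx !andbF. Qed.

Definition torso : graph := Graph torso_sym torso_irr.

Lemma card_torso : #|torso| = #|Y|.
Proof. by rewrite card_sig; apply: eq_card. Qed.

(** The point [x0] only provides a default that makes the colouring total on [G]; injectivity holds
    because [Y :&: S] is a clique of the torso. *)
Lemma torso_colorable n x0 : x0 \in Y -> colorable torso n ->
  exists2 c : G -> 'I_n, {in Y &, forall x y, edge x y -> c x != c y}
    & {in Y :&: S &, injective c}.
Proof.
move=> x0Y /colorableP[c cP]; pose c' x := c (insubd (Sub x0 x0Y : torso) x).
have c'E x (xY : x \in Y) : c' x = c (Sub x xY : torso).
  by congr c; apply: val_inj; rewrite val_insubd xY.
exists c' => [x y xY yY xy|x y /setIP[xY xS] /setIP[yY yS]]; rewrite !c'E.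
  by apply: cP; rewrite /edge /= /torso_rel xy.
move=> cc; apply: contraTeq isT => xy.
have := cP (Sub x xY) (Sub y yY); rewrite cc eqxx; apply.
by rewrite /edge /= /torso_rel /= xS yS xy orbT.
Qed.

(** The bags are [E s] at the vertices of [S] and singletons elsewhere. As [E s] contains [s], the
    original edges survive, and the clique supplies the added ones. *)
Lemma torso_minor (e : rel G) (E : G -> {set G}) :
  subrel e edge -> rooted_clique e S E ->
  (forall s, s \in S -> [disjoint E s & Y :\: S]) -> minor torso G.
Proof.
move=> se [E1 E2] dE; apply/minorP.
exists (fun x : torso => if val x \in S then E (val x) else [set val x]).
have in_bag (x : torso) : val x \in if val x \in S then E (val x) else [set val x].
  by case: ifP => [/E1[]|_]; rewrite ?set11.
split=> [x|x|x y xy|x y].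
- by apply/set0Pn; exists (val x).
- case: ifP => [/E1[_]|_]; last exact: set_connected1.
  exact: set_connected_subrel.
- case: ifP => xS; case: ifP => yS.
  + by apply: (E2 _ _ xS yS _).1; rewrite (inj_eq val_inj).
  + by apply: disjointWr (dE _ xS); rewrite sub1set inE yS (valP y).
  + by rewrite disjoint_sym; apply: disjointWr (dE _ yS); rewrite sub1set inE xS (valP x).
  by rewrite disjoints1 inE (inj_eq val_inj).
case/orP=> [xy|/and3P[xS yS xy]]; first by exists (val x) => //; exists (val y).
rewrite xS yS; have [_ [a ax [b bY /se ab]]] := E2 _ _ xS yS xy.
by exists a => //; exists b.
Qed.

End Torso.

Lemma induced_minor (G : graph) (Y : {set G}) : minor (torso Y set0) G.
Proof.
apply: (@torso_minor _ _ _ edge (fun=> set0)) => [//||s]; last by rewrite inE.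
by split=> s; rewrite inE.
Qed.

Lemma card_torso_lt (G : graph) (Y S : {set G}) w : w \notin Y -> #|torso Y S| < #|G|.
Proof.
move=> wY; rewrite card_torso -[#|G|]cardsT; apply: proper_card.
by rewrite properT; apply: contraNneq wY => ->.
Qed.

(** Serves to permute colours until two colourings agree on a separator. Each new vertex costs one
    transposition, which fixes the values already matched. *)
Lemma extend_injection (T I : finType) (f g : T -> I) (S : {set T}) :
  {in S &, injective f} -> {in S &, injective g} ->
  exists2 tau : I -> I, injective tau & {in S, forall s, tau (f s) = g s}.
Proof.
have [n] := ubnP #|S|; elim: n S => // n IHn S Sn fI gI.
have [->|[s sS]] := set_0Vmem S; first by exists id => // s; rewrite inE.
have sub : {subset S :\ s <= S} by apply/subsetP/subsetDl.
have [|||tau tauI tauE] := IHn (S :\ s).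
- by rewrite -ltnS (leq_trans _ Sn) // ltnS [in X in _ < X](cardsD1 s) sS.
- exact: sub_in2 fI.
- exact: sub_in2 gI.
exists (fun i => tperm (tau (f s)) (g s) (tau i)); first by move=> i j /perm_inj/tauI.
move=> t tS; have [->|ts] := eqVneq t s; first by rewrite tpermL.
have tS' : t \in S :\ s by rewrite !inE ts.
rewrite (tauE t tS') tpermD //; apply: contraNneq ts => E; apply/eqP.
  by apply: fI => //; apply: tauI; rewrite (tauE t tS').
exact/esym/gI.
Qed.

(** A separator is encoded by one of its sides [W], as [nbhd edge W]; the second condition says that
    something remains beyond it. *)
Definition separating (G : graph) (W : {set G}) : bool :=
  (W != set0) && (W :|: nbhd edge W != setT).

(** * Smallest separators of a minimal counterexample *)

Section MinimalSeparation.
Variables (G : graph) (p : nat).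
Hypotheses (minG : minimal_counterexample G) (chiG : chromatic_number G = p.+1).

(** The rest of [G] is a proper minor and has a colouring with [p] colours. At least
    [p - #|nbhd edge W|] of them are missing on the separator, and these could be used on [W]. *)
Lemma side_not_colorable (W : {set G}) : separating W -> #|nbhd (@edge G) W| <= p ->
  ~~ colorable (torso W set0) (p - #|nbhd (@edge G) W|).
Proof.
case/andP=> /set0Pn[w wW] WN Sp; apply/negP=> /(torso_colorable wW)[d dP _].
have [x0 x0W] : exists x0, x0 \notin W :|: nbhd edge W.
  by apply/existsP; rewrite -negb_forall; apply: contraNN WN => /forallP WT;
    apply/eqP/setP=> x; rewrite WT inE.
have {x0W}x0W : x0 \in ~: W by move: x0W; rewrite !inE negb_or => /andP[].
have : colorable (torso (~: W) set0) p.
  apply: small_minor_colorable minG chiG (induced_minor _) _.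
  by apply: (@card_torso_lt _ _ _ w); rewrite inE wW.
case/(torso_colorable x0W)=> c cP _.
pose U := c @: nbhd edge W.
have Up : p - #|nbhd (@edge G) W| <= #|~: U|.
  have := cardsC U; rewrite card_ord => cU.
  by rewrite leq_subLR -[leqLHS]cU leq_add2r leq_imset_card.
pose h (i : 'I_(p - #|nbhd (@edge G) W|)) : 'I_p := enum_val (widen_ord Up i).
have hU i : h i \notin U by have := enum_valP (widen_ord Up i); rewrite inE.
have hI : injective h by move=> i j /enum_val_inj/(congr1 val)/= ij; apply: val_inj.
suff : colorable G p by rewrite -chromatic_number_leq chiG ltnn.
have cross x y : edge x y -> x \in W -> y \notin W -> h (d x) != c y.
  move=> xy xW yW; apply: contraNneq (hU (d x)) => ->; apply: imset_f.
  by apply/nbhdP; split=> //; exists x.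
apply/colorableP; exists (fun x => if x \in W then h (d x) else c x) => x y xy.
have [xW|xW] := ifPn; have [yW|yW] := ifPn.
- by rewrite (inj_eq hI); apply: dP.
- exact: cross.
- by rewrite eq_sym; apply: cross; rewrite // edge_sym.
by apply: cP; rewrite ?inE.
Qed.

(** A clique minor of [W] is linked to the separator, so contractions within [W] and the separator
    complete the separator for the opposite side. *)
Lemma side_torso_colorable (W : {set G}) : separating W ->
  (forall W', separating W' -> #|nbhd (@edge G) W| <= #|nbhd (@edge G) W'|) ->
  8 * #|nbhd (@edge G) W| <= p ->
  colorable (torso (~: W) (nbhd (@edge G) W)) p.
Proof.
set S := nbhd (@edge G) W => sepW minW Sp.
have Sp1 : #|S| <= p by apply: leq_trans Sp; apply: leq_pmull.
(* Minimality yields a clique minor only under a double negation, so the goal is first turned into a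
   contradiction. *)
apply: contraT => ncol; exfalso.
have nT := side_not_colorable sepW Sp1.
have [/set0Pn[w wW] WN] := andP sepW.
have [x0 x0W] : exists x0, x0 \notin W :|: S.
  by apply/existsP; rewrite -negb_forall; apply: contraNN WN => /forallP WT;
    apply/eqP/setP=> x; rewrite WT inE.
have cT : #|torso W set0| < #|G|.
  by apply: (@card_torso_lt _ _ _ x0); apply: contra x0W; rewrite inE => ->.
apply: (minG.2 (torso W set0)).
  split; first exact: induced_minor.
  by case=> f fb _; rewrite (bij_eq_card fb) ltnn in cT.
case/minorP=> phi mphi.
have nchi : (p - #|S|).+1 <= chromatic_number (torso W set0).
  by rewrite ltnNge chromatic_number_leq.
have valM : is_model (fun x : torso W set0 => [set val x]).
  apply: is_model_inj; first exact: val_inj.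
  by move=> x y; rewrite {1}/edge /= /torso_rel !inE orbF.
have := is_model_trans (is_model_complete nchi mphi) valM.
set D := fun k => \bigcup_(h in _) _.
case=> neD cD dD eD.
have DW i : D i \subset W.
  by apply/bigcupsP=> x _; rewrite sub1set (valP x).
pose e1 := restrict (@edge G) (W :|: S).
have se1 : subrel e1 edge by move=> x y /and3P[].
have dWS : [disjoint W & S].
  by apply/pred0P=> x /=; apply/negP=> /andP[xW /nbhdP[]]; rewrite xW.
have in1 x y : x \in W -> edge x y -> e1 x y.
  move=> xW xy; rewrite /e1 /restrict xy !inE xW andbT /=.
  have [//|yW /=] := boolP (y \in W).
  by apply/exists_inP; exists x.
have [|||||||E rE] := @rooted_clique_exists G (p - #|S|).+1 e1 S D.
- by apply: restrict_sym; apply: edge_sym.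
(* This amounts to [3 * #|S| <= p], which follows from [Sp]. *)
- rewrite ltnS leq_subRL // -muln2 -[X in X + _]muln1 -mulnDr mulnC.
  by apply: leq_trans Sp; rewrite leq_mul2r orbT.
- move=> i x F xi xF clF; apply: (cD i x) => // a b aF aD bD ab.
  exact: clF aF aD bD (in1 _ _ (subsetP (DW i) a aD) ab).
- by move=> i; apply: disjointWl (DW i) dWS.
- by move=> i j ij; apply: dD.
- move=> i j ij; have [x xi [y yj xy]] := eD i j ij.
  by exists x => //; exists y => //; apply: in1 xy; apply: (subsetP (DW i)).
(* The set [W1 :&: W] is separating in [G], since [x0] stays out of reach, so [minW] bounds its
   neighbourhood. As [W1] misses [S], that neighbourhood lies in the one of [W1] for [e1]. *)
- apply/well_linkedP=> W1 i W1S iW1.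
  apply: leq_trans (_ : #|nbhd (@edge G) (W1 :&: W)| <= _).
    apply: minW; apply/andP; split.
      have /set0Pn[x xi] := neD i; apply/set0Pn; exists x.
      by rewrite inE (subsetP iW1) ?(subsetP (DW i)).
    apply: contraNneq x0W => /setP/(_ x0); rewrite in_setT => /setUP[/setIP[_ x0W]|].
      by rewrite inE x0W.
    case/nbhdP=> _ [x /setIP[_ xW] xx0]; have /and3P[//] := in1 _ _ xW xx0.
  apply: subset_leq_card; apply/subsetP=> y /nbhdP[yW [x /setIP[x1 xW] xy]].
  have e1xy := in1 _ _ xW xy; apply/nbhdP; split; last by exists x.
  apply: contra yW => y1; rewrite inE y1.
  have /and3P[_ /setUP[//|yS] _] := e1xy.
  by have /pred0P/(_ y) := W1S; rewrite /= y1 yS.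
apply: (negP ncol); apply: small_minor_colorable minG chiG _ _; last first.
  by apply: (@card_torso_lt _ _ _ w); rewrite inE wW.
apply: (torso_minor se1 rE) => s sS; have [sE cE] := rE.1 s sS.
have sWS : s \in W :|: S by rewrite inE sS orbT.
apply: disjointWl (set_connected_restrict cE sE sWS) _.
by apply/pred0P=> x /=; rewrite !inE; case: (x \in W); rewrite ?andbF //= andbT andbN.
Qed.

(** No edge joins [W] to the far side, so the neighbours of the far side lie in [nbhd edge W];
    minimality gives equality. Hence results on [W] apply to both sides. *)
Lemma opposite_side (W : {set G}) : separating W ->
  (forall W', separating W' -> #|nbhd (@edge G) W| <= #|nbhd (@edge G) W'|) ->
  [/\ separating (~: (W :|: nbhd edge W)) &
      nbhd edge (~: (W :|: nbhd edge W)) = nbhd edge W].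
Proof.
move=> /andP[/set0Pn[w wW] WN] minW; set W2 := ~: _.
have sub : nbhd edge W2 \subset nbhd edge W.
  apply/subsetP=> y /nbhdP[]; rewrite in_setC negbK => /setUP[yW [x]|//].
  rewrite in_setC in_setU negb_or => /andP[xW /nbhdP xN] xy; case: xN.
  by split=> //; exists y; rewrite // edge_sym.
have sepW2 : separating W2.
  apply/andP; split; first by rewrite -setCT (inj_eq (@setC_inj _)).
  apply/eqP=> /setP/(_ w); rewrite in_setT => /setUP[].
    by rewrite in_setC in_setU wW.
  by move/(subsetP sub)/nbhdP=> []; rewrite wW.
by split=> //; apply/eqP; rewrite eqEcard sub minW.
Qed.

(** Otherwise both torsos, which overlap in the separator, have colourings with [p] colours, and
    these glue to one of [G]. *)
Lemma separating_card (W : {set G}) : separating W ->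
  (forall W', separating W' -> #|nbhd (@edge G) W| <= #|nbhd (@edge G) W'|) ->
  p < 8 * #|nbhd (@edge G) W|.
Proof.
move=> sepW minW; rewrite ltnNge; apply/negP=> Sp.
have [sepW2 N2] := opposite_side sepW minW.
set S := nbhd (@edge G) W in Sp N2; set W2 := ~: (W :|: S) in sepW2 N2.
have col1 := side_torso_colorable sepW minW Sp.
have col2 : colorable (torso (~: W2) S) p.
  by rewrite -N2; apply: side_torso_colorable; rewrite ?N2.
have [/set0Pn[w wW] _] := andP sepW; have [/set0Pn[w2 w2W] _] := andP sepW2.
have w2W' : w2 \in ~: W by move: w2W; rewrite !inE negb_or => /andP[].
have wW' : w \in ~: W2 by rewrite !inE wW.
have [c cP cS] := torso_colorable w2W' col1.
have [d dP dS] := torso_colorable wW' col2.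
have SW : S \subset ~: W by apply/subsetP=> s /nbhdP[]; rewrite inE.
have SW2 : S \subset ~: W2 by rewrite setCK subsetUr.
rewrite (setIidPr SW) in cS; rewrite (setIidPr SW2) in dS.
have [tau tauI tauE] := extend_injection cS dS.
suff : colorable G p by rewrite -chromatic_number_leq chiG ltnn.
pose col x := if x \in W then d x else tau (c x).
have colE x : x \in ~: W2 -> col x = d x.
  by rewrite setCK /col => /setUP[->//|xS]; case: ifP => // _; rewrite tauE.
apply/colorableP; exists col => x y xy.
have far a b : edge a b -> a \in W2 -> a \notin W /\ b \notin W.
  rewrite in_setC in_setU negb_or => ab /andP[aW aS]; split=> //.
  by apply: contra aS => bW; apply/nbhdP; split=> //; exists b; rewrite // edge_sym.
(* Since no edge joins [W] to [W2], each edge lies within the domain of one of the two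
   colourings. *)
suff [[x2 y2]|[xW yW]] : (x \in ~: W2 /\ y \in ~: W2) \/ (x \notin W /\ y \notin W).
- by rewrite !colE //; apply: dP.
- by rewrite /col (negPf xW) (negPf yW) (inj_eq tauI); apply: cP; rewrite ?in_setC.
rewrite ![_ \in ~: W2]in_setC.
have [/(far _ _ xy)|_] := boolP (x \in W2); first by right.
have [|_] := boolP (y \in W2); last by left.
by rewrite edge_sym in xy; case/(far _ _ xy); right.
Qed.

End MinimalSeparation.

(** Clique minors of order 0 and 1 come for free. The case [k = 1] must be excluded because
    [ceil_div k 8 < k] fails there. *)
Lemma minimal_counterexample_chromatic_gt1 (G : graph) :
  minimal_counterexample G -> 1 < chromatic_number G.
Proof.
case=> cex _; rewrite ltnNge; apply/negP=> chi1; apply: cex; apply/minorP.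
have [x0|G0] := pickP (fun x : G => true).
  exists (fun=> [set x0]); split=> [h|h|h h'|h h'].
  - by apply/set0Pn; exists x0; rewrite set11.
  - exact: set_connected1.
  - by case: h h' => [[|h] hP] [[|h'] h'P] //; move: hP h'P;
    case: chromatic_number chi1 => [|[]].
  by case: h h' => [[|h] hP] [[|h'] h'P] //; move: hP h'P;
    case: chromatic_number chi1 => [|[]].
have : chromatic_number G <= 0.
  rewrite chromatic_number_leq; apply/colorableP.
  by exists (fun x : G => False_rect _ (notF (esym (G0 x)))) => x; have := G0 x.
case: chromatic_number => // _.
by exists (fun=> set0); split=> -[].
Qed.

Theorem theorem3 (k : nat) (hk : 0 < k) (G : graph)
    (hchi : chromatic_number G = k) (hmin : minimal_counterexample G) :
  m_connected (ceil_div k 8) G.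
Proof.
have k1 := minimal_counterexample_chromatic_gt1 hmin.
rewrite hchi in k1.
have kG : k <= #|G|.
  rewrite -hchi chromatic_number_leq; apply/colorableP; exists enum_rank => x y xy.
  by apply: contraTneq xy => /enum_rank_inj->; rewrite edge_irr.
split.
  apply: leq_trans kG; rewrite ltn_divLR //=.
  by case: k k1 {hk hchi} => [|[|k]] // _; rewrite mulSn mulSn; lia.
move=> Z; rewrite leq_divRL //= => Zk x y.
apply: contraT => nxy.
(* The component of [x] after deleting [Z], seen in [G]: its neighbours lie in [Z], and [y] is
   beyond them. *)
pose W0 := [set val z | z in [pred z | connect (@edge (delete Z)) x z]].
have NW0 : nbhd edge W0 \subset Z.
  apply/subsetP=> b /nbhdP[bW [_ /imsetP[a xa ->] ab]]; apply: contraNT bW => bZ.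
  apply/imsetP; exists (Sub b bZ : delete Z) => //.
  by apply: connect_trans xa (connect1 _).
have sep0 : separating W0.
  apply/andP; split.
    by apply/set0Pn; exists (val x); apply: imset_f; apply: connect0.
  apply/eqP=> /setP/(_ (val y)); rewrite in_setT => /setUP[/imsetP[z xz]|].
    by move/val_inj=> yz; rewrite inE -yz in xz; rewrite xz in nxy.
  by move/(subsetP NW0)=> yZ; have := valP y; rewrite yZ.
have [W sepW minW] := arg_minnP (fun W : {set G} => #|nbhd (@edge G) W|) sep0.
case: k hchi hk k1 kG Zk => // p chiG _ _ _ Zk.
(* With [k = p.+1], [Zk] says [8 * #|Z| <= p], while the smallest separator has at most [#|Z|]
   vertices. *)
have := separating_card hmin chiG sepW minW.
rewrite ltnNge => /negP; case.
have := leq_trans (minW _ sep0) (subset_leq_card NW0).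
lia.
Qed.
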